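(* Let $a\ge 1$, $m\ge 1$ and $n\ge 3$ be integers and let $GW(a,m,n)=aK_m\nabla C_n$ be the generalized wheel graph on $am+n$ vertices. The distance signless Laplacian spectrum of $GW(a,m,n)$ consists of the eigenvalue $2(a-1)m+n-2$ with multiplicity $a-1$, the eigenvalue $(2a-1)m+n-2$ with multiplicity $a(m-1)$, the eigenvalues $am+2n-6-2\cos\left(\frac{2\pi j}{n}\right)$ for $1\le j\le n-1$ (each counted once for each $j$), and the remaining two eigenvalues $$\frac{(5a-2)m+5n-10}{2}\pm\frac{\sqrt{((3a-2)m-3n+6)^2+4amn}}{2}.$$
   Context: For a connected graph $G$, $D(G)$ is its distance matrix (entries $d(u,v)$, the length of a shortest $u$–$v$ path), $Tr(G)$ is the diagonal matrix of row sums of $D(G)$ (transmissions), and the distance signless Laplacian is $D^Q(G)=Tr(G)+D(G)$. $kG$ denotes the disjoint union of $k$ copies of $G$; $G_1\nabla G_2$ (join) is obtained from the disjoint union $G_1\cup G_2$ by adding all edges between $V(G_1)$ and $V(G_2)$. $K_m$ is the complete graph and $C_n$ the cycle. The generalized wheel graph is $GW(a,m,n)=aK_m\nabla C_n$. *)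

(* Defs.v *)
From mathcomp Require Import all_boot all_order all_algebra.
From mathcomp Require Import reals trigo.

Set Implicit Arguments.
Unset Strict Implicit.
Unset Printing Implicit Defensive.

Import Order.TTheory GRing.Theory Num.Theory.

Record sgraph := SGraph {
  vertex :> finType;
  adj : rel vertex;
  adj_sym : symmetric adj;
  adj_irrefl : irreflexive adj }.

Section CompleteGraph.
Variable m : nat.

Definition complete_adj : rel 'I_m := fun i j => i != j.

Lemma complete_adj_sym : symmetric complete_adj.
Proof. by move=> i j; rewrite /complete_adj eq_sym. Qed.

Lemma complete_adj_irrefl : irreflexive complete_adj.
Proof. by move=> i; rewrite /complete_adj eqxx. Qed.

Definition complete_graph : sgraph :=
  SGraph complete_adj_sym complete_adj_irrefl.

End CompleteGraph.

Section CycleGraph.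
Variable n : nat.

(* This is the cycle on n vertices only for n >= 3. The conjunct [i != j]
   matters only for n = 1, where [ordS] has a fixed point. *)
Definition cycle_adj : rel 'I_n :=
  fun i j => (i != j) && ((j == ordS i) || (i == ordS j)).

Lemma cycle_adj_sym : symmetric cycle_adj.
Proof. by move=> i j; rewrite /cycle_adj eq_sym orbC. Qed.

Lemma cycle_adj_irrefl : irreflexive cycle_adj.
Proof. by move=> i; rewrite /cycle_adj eqxx. Qed.

Definition cycle_graph : sgraph := SGraph cycle_adj_sym cycle_adj_irrefl.

End CycleGraph.

Section Copies.
Variables (k : nat) (G : sgraph).

Definition copies_adj : rel ('I_k * G)%type :=
  fun x y => (x.1 == y.1) && adj x.2 y.2.

Lemma copies_adj_sym : symmetric copies_adj.
Proof. by move=> x y; rewrite /copies_adj eq_sym adj_sym. Qed.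

Lemma copies_adj_irrefl : irreflexive copies_adj.
Proof. by move=> x; rewrite /copies_adj adj_irrefl andbF. Qed.

Definition copies : sgraph := SGraph copies_adj_sym copies_adj_irrefl.

End Copies.

Section Join.
Variables G1 G2 : sgraph.

Definition join_adj : rel (G1 + G2)%type := fun x y =>
  match x, y with
  | inl u, inl v => adj u v
  | inr u, inr v => adj u v
  | _, _ => true
  end.

Lemma join_adj_sym : symmetric join_adj.
Proof. by move=> [u|u] [v|v] //=; rewrite adj_sym. Qed.

Lemma join_adj_irrefl : irreflexive join_adj.
Proof. by move=> [u|u] /=; rewrite adj_irrefl. Qed.

Definition join_graph : sgraph := SGraph join_adj_sym join_adj_irrefl.

End Join.

Definition generalized_wheel (a m n : nat) : sgraph :=
  join_graph (copies a (complete_graph m)) (cycle_graph n).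

Section Distance.
Variable G : sgraph.

(* The path is u :: p; its length is the number k of its edges. *)
Definition has_path (u v : G) (k : nat) : bool :=
  [exists p : k.-tuple G,
    [&& path (@adj G) u p, last u p == v & uniq (u :: p)]].

(* The least k such that [has_path u v k]; a path has fewer than #|G| edges.
   The value is #|G| when no path joins u to v, which does not happen in a
   connected graph. *)
Definition dist (u v : G) : nat := find (has_path u v) (iota 0 #|G|).

End Distance.

Local Open Scope ring_scope.

Section DistanceMatrices.
Variables (R : realType) (G : sgraph).

(* Rows and columns are indexed by the position of a vertex in [enum G]. *)
Definition dist_mx : 'M[R]_#|G| :=
  \matrix_(i, j) (dist (enum_val i) (enum_val j))%:R.

Definition transmission_mx : 'M[R]_#|G| :=
  diag_mx (\row_i \sum_j dist_mx i j).

Definition dist_signless_laplacian : 'M[R]_#|G| := transmission_mx + dist_mx.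

End DistanceMatrices.

(* The sequence s, read as a multiset, lists all the eigenvalues of A with
   their multiplicities as roots of the characteristic polynomial; for a
   symmetric real matrix these are also the dimensions of the eigenspaces. *)
Definition is_spectrum (R : realType) (k : nat) (A : 'M[R]_k) (s : seq R) :
  Prop := char_poly A = \prod_(x <- s) ('X - x%:P).

(* Main.v *)
Require Import Defs.
From mathcomp Require Import all_boot all_order all_algebra.
From mathcomp Require Import reals trigo.
From mathcomp Require Import perm.
From mathcomp Require Import ring lra zify.

Set Implicit Arguments.
Unset Strict Implicit.
Unset Printing Implicit Defensive.

Import Order.TTheory GRing.Theory Num.Theory.
Local Open Scope ring_scope.

(* In a join of nonempty graphs d(u,v) = 2 - 2[u = v] - A(u,v), where A is the
   adjacency relation. For G1 and G2 regular of degrees r1 and r2 on n1 and n2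
   vertices, 'X - D^Q of their join is therefore
     diag(y1 + A1, y2 + A2) - U C U^T,
   with U the 0/1 indicator of the two sides, C = [[2, 1], [1, 2]] and y1, y2 of
   the form 'X - constant. By regularity the columns of U span an invariant
   space of the block-diagonal part, so the matrix determinant lemma gives
     det('X - D^Q) (y1 + r1) (y2 + r2)
     = det(y1 + A1) det(y2 + A2) ((y1 + r1 - 2 n1) (y2 + r2 - 2 n2) - n1 n2).
   The same lemma evaluates det(y + A) for aK_m, and the basis of the functions
   cos + sin (discrete Hartley transform) diagonalises C_n over the reals. *)

(** * Determinants indexed by finite types *)

Definition fdet (S : comNzRingType) (T : finType) (F : T -> T -> S) : S :=
  \det (\matrix_(i, j < #|T|) F (enum_val i) (enum_val j)).

(** Reordering the vertices permutes rows and columns alike, so the two signs cancel. The cycle can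
    thus be indexed by its own ordinals, and a join by one side after the other. *)
Lemma fdet_bij (S : comNzRingType) (T : finType) (F : T -> T -> S) (k : nat)
    (f : 'I_k -> T) :
  bijective f -> fdet F = \det (\matrix_(i, j) F (f i) (f j)).
Proof.
move=> bij_f; have Ek : k = #|T| by rewrite -(bij_eq_card bij_f) card_ord.
subst k; have inj_s : injective (enum_rank \o f).
  by apply: inj_comp; [apply: enum_rank_inj | apply: bij_inj].
have -> : \matrix_(i, j) F (f i) (f j) = row_perm (perm inj_s)
    (col_perm (perm inj_s) (\matrix_(i, j) F (enum_val i) (enum_val j))).
  by apply/matrixP=> i j; rewrite !mxE !permE /= !enum_rankK.
rewrite row_permE col_permE !det_mulmx !det_perm odd_permV mulrCA.
by rewrite -signr_addb addbb mulr1.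
Qed.

(* Both sides are the determinant of [block_mx B U W 1%:M] times [\det D]; no
   inverse of B is involved, so B may have polynomial entries. *)
Lemma det_intertwine (S : comNzRingType) (k l : nat) (B : 'M[S]_k)
    (U : 'M_(k, l)) (W : 'M_(l, k)) (D : 'M_l) :
  B *m U = U *m D -> \det (B - U *m W) * \det D = \det B * \det (D - W *m U).
Proof.
move=> BU; have <- : \det (block_mx B U W 1%:M) = \det (B - U *m W).
  have := det_mulmx (block_mx B U W 1%:M) (block_mx 1%:M 0 (- W) 1%:M).
  rewrite mulmx_block det_lblock !det1 !mulr1 => <-.
  by rewrite !mulmx1 !mulmx0 mul1mx mulmxN subrr !add0r det_ublock det1 mulr1.
have := det_mulmx (block_mx B U W 1%:M) (block_mx 1%:M (- U) 0 D).
rewrite mulmx_block det_ublock !det1 !mul1r => <-.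
rewrite !mulmx1 !mulmx0 mul1mx !mulmxN BU addNr !addr0 det_lblock.
by rewrite [- _ + D]addrC.
Qed.

(** * Adjacency determinants of disjoint unions of complete graphs *)

Definition adj_fun (S : comNzRingType) (G : sgraph) (y : S) (u v : G) : S :=
  (u == v)%:R * y + (adj u v)%:R.

Lemma sum_eq_mull (S : comNzRingType) (T : finType) (i : T) (F : T -> S) :
  \sum_k (i == k)%:R * F k = F i.
Proof.
rewrite (bigD1 i) //= eqxx mul1r big1 ?addr0 // => k /negbTE.
by rewrite eq_sym => ->; rewrite mul0r.
Qed.

Lemma sum_eq_mulr (S : comNzRingType) (T : finType) (i : T) (F : T -> S) :
  \sum_k F k * (k == i)%:R = F i.
Proof.
rewrite -[RHS]sum_eq_mull; apply: eq_bigr => k _.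
by rewrite mulrC eq_sym.
Qed.

Lemma sum_enum_val (S : comNzRingType) (T : finType) (F : T -> S) :
  \sum_(i < #|T|) F (enum_val i) = \sum_x F x.
Proof. by rewrite -(big_enum_val F). Qed.

(** If U is the indicator matrix of the copies, then A = U U^T - I and U^T U = m I. The matrix
    determinant lemma, with scalar matrices for B and D, gives the formula up to the factor (y -
    1)^a, which y != 1 allows to cancel. *)
Lemma adj_det_copies_complete (S : idomainType) (a m : nat) (y : S) :
    (0 < m)%N -> y != 1 ->
  fdet (adj_fun (G := copies a (complete_graph m)) y)
    = (y - 1) ^+ (a * (m - 1)) * (y - 1 + m%:R) ^+ a.
Proof.
move=> m_gt0 y_neq1; set G := copies a _.
have y1_neq0 : (y - 1) ^+ a != 0 by rewrite expf_neq0 // subr_eq0.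
apply: (mulIf y1_neq0).
pose U : 'M[S]_(#|G|, a) := \matrix_(i, p) ((enum_val i).1 == p)%:R.
have UU : U^T *m U = m%:R%:M.
  apply/matrixP=> p q; rewrite !mxE.
  under eq_bigr do rewrite !mxE.
  rewrite (sum_enum_val (fun x : G => (x.1 == p)%:R * (x.1 == q)%:R)).
  rewrite -(pair_bigA _ (fun i (_ : 'I_m) => (i == p)%:R * (i == q)%:R)) /=.
  under eq_bigr do rewrite sumr_const card_ord eq_sym -mulrnAr.
  by rewrite sum_eq_mull mulrnAC.
have -> : fdet (adj_fun (G := G) y) = \det ((y - 1)%:M - U *m (- U^T)).
  congr (\det _); apply/matrixP=> i j; rewrite mulmxN opprK !mxE.
  under eq_bigr do rewrite !mxE.
  rewrite sum_eq_mull -(inj_eq enum_val_inj) /adj_fun /=.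
  case: (enum_val i) (enum_val j) => [p u] [q v] /=.
  rewrite /copies_adj -pair_eqE /pair_eq /= /complete_adj [q == p]eq_sym.
  case: (p == q); case: (u == v) => /=; rewrite ?mul1r ?mul0r ?addr0 ?add0r //.
  by rewrite mulr1n subrK.
rewrite -[X in _ * X]det_scalar det_intertwine; last first.
  by rewrite scalar_mxC.
rewrite mulNmx UU opprK -raddfD !det_scalar card_prod !card_ord.
rewrite [RHS]mulrAC -exprD; congr (_ ^+ _ * _).
by rewrite mulnBr muln1 subnK // leq_pmulr.
Qed.

(** * Trigonometric sums and the Hartley kernel *)

Definition cas (R : realType) (x : R) : R := cos x + sin x.

(** This is the eigenvector equation of the cycle: summing over the two neighbours multiplies by 2
    cos x. *)
Lemma casD_add_casB (R : realType) (x y : R) :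
  cas (y + x) + cas (y - x) = 2 * cos x * cas y.
Proof. rewrite /cas cosD cosB sinD sinB; ring. Qed.

Lemma casMcas (R : realType) (x y : R) :
  cas x * cas y = cos (x - y) + sin (x + y).
Proof. rewrite /cas cosB sinD; ring. Qed.

Lemma cos_int_period (R : realType) (k : nat) : cos (2 * pi * k%:R) = 1 :> R.
Proof.
rewrite mulr_natl mulr_natr; elim: k => [|k IHk]; first by rewrite cos0.
by rewrite mulrSr cosD2pi.
Qed.

Lemma cos1_sin0 (R : realType) (x : R) : cos x = 1 -> sin x = 0.
Proof. by move=> cx; apply: cos1sin0; rewrite cx normr1. Qed.

Lemma sum_shift_cyclic (V : zmodType) (n : nat) (f : nat -> V) :
  f n = f 0%N -> \sum_(k < n) f k.+1 = \sum_(k < n) f k.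
Proof.
move=> fn; apply: (addrI (f 0%N)); transitivity (\sum_(k < n.+1) f k).
  by rewrite big_ord_recl.
by rewrite big_ord_recr /= fn addrC.
Qed.

(** As cos (n x) = 1, shifting the index preserves both sums; it also rotates the vector of the two
    sums by x. Unless cos x = 1, the only vector fixed by this rotation is 0. *)
Lemma sum_cos_sin (R : realType) (n : nat) (x : R) : cos (n%:R * x) = 1 ->
  \sum_(k < n) cos (k%:R * x) = (cos x == 1)%:R * n%:R
  /\ \sum_(k < n) sin (k%:R * x) = 0.
Proof.
move=> cnx; have snx := cos1_sin0 cnx.
case: eqP => [cx | /eqP cx_neq1].
  have cs k : cos (k%:R * x) = 1.
    elim: k => [|k IHk]; first by rewrite mul0r cos0.
    by rewrite -natr1 mulrDl mul1r cosD IHk cx (cos1_sin0 cx) mulr0 subr0 mul1r.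
  split; first by rewrite (eq_bigr (fun=> 1)) // sumr_const card_ord mul1r.
  by apply: big1 => k _; apply: cos1_sin0.
rewrite mul0r; set C := \sum_k _; set S := \sum_k _.
have C_shift : C = cos x * C - sin x * S.
  rewrite !mulr_sumr -sumrB.
  rewrite -[LHS](@sum_shift_cyclic _ n (fun k => cos (k%:R * x))).
    by apply: eq_bigr => k _; rewrite -natr1 mulrDl mul1r cosD; ring.
  by rewrite cnx mul0r cos0.
have S_shift : S = sin x * C + cos x * S.
  rewrite !mulr_sumr -big_split.
  rewrite -[LHS](@sum_shift_cyclic _ n (fun k => sin (k%:R * x))) /=.
    by apply: eq_bigr => k _; rewrite -natr1 mulrDl mul1r sinD; ring.
  by rewrite snx mul0r sin0.
(* This is the determinant of the identity minus the rotation by x; the combinations of [C_shift]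
   and [S_shift] below are Cramer's rule. *)
have norm_neq0 : 2 * (1 - cos x) != 0.
  by rewrite mulf_neq0 ?pnatr_eq0 // subr_eq0 eq_sym.
have norm_eq : 2 * (1 - cos x) = (1 - cos x) ^+ 2 + sin x ^+ 2.
  rewrite sin2cos2; ring.
split; apply: (mulfI norm_neq0); rewrite mulr0 norm_eq.
  transitivity ((1 - cos x) * (C - (cos x * C - sin x * S))
    - sin x * (S - (sin x * C + cos x * S))); first by ring.
  by rewrite -C_shift -S_shift !subrr !mulr0 subrr.
transitivity (sin x * (C - (cos x * C - sin x * S))
  + (1 - cos x) * (S - (sin x * C + cos x * S))); first by ring.
by rewrite -C_shift -S_shift !subrr !mulr0 addr0.
Qed.

(** * Adjacency determinant of the cycle *)

Lemma cos_lt1 (R : realType) (x : R) : 0 < x < 2 * pi -> cos x < 1.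
Proof.
move=> x_int; have -> : x = (x / 2) *+ 2 by rewrite -mulr_natr divfK ?pnatr_eq0.
rewrite cos_mulr2n cos2sin2.
have /sin_gt0_pi : 0 < x / 2 < pi by lra.
move=> s_gt0; have := exprn_gt0 2 s_gt0; lra.
Qed.

(** For n > 2 the successor and the predecessor of i differ, so the disjunction becomes a sum; for n
    = 2 they coincide and the right side would count the edge twice. *)
Lemma cycle_adjE (S : comNzRingType) (n : nat) (i j : 'I_n) : (2 < n)%N ->
  (cycle_adj i j)%:R = (j == ordS i)%:R + (j == ord_pred i)%:R :> S.
Proof.
move=> n_gt2; have n_gt0 : (0 < n)%N by apply: leq_trans n_gt2.
have succ_mod k : (k < n)%N -> (k.+1 %% n = if k.+1 == n then 0 else k.+1)%N.
  by move=> lt_kn; case: eqVneq => [->|]; rewrite ?modnn // => ?;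
    rewrite modn_small //; lia.
have ordS_neq k : k != ordS k :> 'I_n.
  rewrite -val_eqE /= succ_mod //; have := ltn_ord k; case: (k.+1 =P n); lia.
have ordSS_neq k : k != ordS (ordS k) :> 'I_n.
  rewrite -val_eqE /= succ_mod ?ltn_mod // succ_mod //.
  by have := ltn_ord k; case: (k.+1 =P n) => ?; case: (_ =P n); lia.
have -> : (j == ord_pred i) = (i == ordS j).
  by rewrite eq_sym (can2_eq (@ord_predK n) (@ordSK n)).
rewrite /cycle_adj; case: (eqVneq i (ordS j)) => [->|_] /=.
  by rewrite [_ == j]eq_sym ordS_neq orbT (negbTE (ordSS_neq j)) add0r.
rewrite orbF addr0; case: (eqVneq j (ordS i)) => [->|_].
  by rewrite ordS_neq.
by rewrite andbF.
Qed.

Section CycleSpectrum.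
Variables (R : realType) (n : nat).
Hypothesis n_gt0 : (0 < n)%N.

Definition cycle_angle (j : nat) : R := 2 * pi * j%:R / n%:R.

(* The columns are real eigenvectors of every symmetric circulant matrix, which
   avoids complex roots of unity. *)
Definition hartley_mx : 'M[R]_n := \matrix_(i, j) cas (i%:R * cycle_angle j).

Lemma mul_cycle_angle j : n%:R * cycle_angle j = 2 * pi * j%:R.
Proof. by rewrite mulrC divfK // pnatr_eq0 -lt0n. Qed.

Lemma cos_cycle_angle_eq1 (j : nat) : (j < n)%N ->
  (cos (cycle_angle j) == 1) = (j == 0%N).
Proof.
move=> lt_jn; apply/eqP/eqP => [|->]; last first.
  by rewrite /cycle_angle mulr0 mul0r cos0.
case: j lt_jn => // j lt_jn; suff /cos_lt1 : 0 < cycle_angle j.+1 < 2 * pi.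
  by move=> /lt_eqF/eqP.
have pi_gt0 := pi_gt0 R; have n0 : 0 < n%:R :> R by rewrite ltr0n.
rewrite /cycle_angle divr_gt0 ?mulr_gt0 ?ltr0n //=.
by rewrite ltr_pdivrMr // ltr_pM2l ?mulr_gt0 // ltr_nat.
Qed.

(** By [casMcas], the entry (j, l) is a cosine sum at the difference of two angles plus a sine sum
    at their sum. The sine sum vanishes, and so does the cosine sum unless j = l. *)
Lemma hartley_mx_sym_sq : hartley_mx^T *m hartley_mx = n%:R%:M.
Proof.
apply/matrixP=> j l; rewrite !mxE.
under eq_bigr do rewrite !mxE casMcas -mulrBr -mulrDr.
rewrite big_split /=.
have cn k : cos (n%:R * cycle_angle k) = 1.
  by rewrite mul_cycle_angle cos_int_period.
have snk k : sin (n%:R * cycle_angle k) = 0 by apply: cos1_sin0.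
have [|-> _] := @sum_cos_sin R n (cycle_angle j - cycle_angle l).
  by rewrite mulrBr cosB !cn !snk mulr0 addr0 mulr1.
have [|_ ->] := @sum_cos_sin R n (cycle_angle j + cycle_angle l).
  by rewrite mulrDr cosD !cn !snk mulr0 subr0 mulr1.
have angleB (p q : nat) : (q <= p)%N ->
    cycle_angle p - cycle_angle q = cycle_angle (p - q).
  by move=> le_qp; rewrite /cycle_angle natrB // -mulrBl -mulrBr.
rewrite addr0 -[RHS]mulr_natl; congr (_ * _).
rewrite -val_eqE /=; congr (nat_of_bool _)%:R.
(* The difference of the angles is the angle of a natural number only if l <= j; the cosine being
   even, this loses nothing. *)
wlog le_lj : j l / (l <= j)%N => [IH|].
  have [/IH //|/ltnW/IH eq_lj] := leqP l j.
  by rewrite -[_ - _]opprB cosN eq_lj eq_sym.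
rewrite angleB // cos_cycle_angle_eq1 ?subn_eq0; last first.
  exact: leq_ltn_trans (leq_subr _ _) (ltn_ord j).
by rewrite eqn_leq le_lj andbT.
Qed.

Lemma hartley_mx_det_neq0 : \det hartley_mx != 0.
Proof.
have n_neq0 : n%:R != 0 :> R by rewrite pnatr_eq0 -lt0n.
have := congr1 determinant hartley_mx_sym_sq.
rewrite det_mulmx det_tr det_scalar => detE.
by have := expf_neq0 n n_neq0; rewrite -detE mulf_eq0 orbb.
Qed.

(** This handles the wrap-around of [ordS]: n times [cycle_angle j] is a multiple of 2 pi. *)
Lemma cas_modD (k j : nat) (x : R) :
  cas ((k %% n)%:R * cycle_angle j + x) = cas (k%:R * cycle_angle j + x).
Proof.
rewrite [in RHS](divn_eq k n) natrD natrM mulrDl -mulrA mul_cycle_angle /=.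
rewrite [X in cas (X + _ + _)]mulrCA -natrM -addrA.
rewrite /cas [in RHS]cosD [sin (2 * pi * _ + _)]sinD cos_int_period.
by rewrite (cos1_sin0 (cos_int_period _ _)); ring.
Qed.

Hypothesis n_gt2 : (2 < n)%N.

Lemma cycle_adj_hartley (i j : 'I_n) :
  \sum_k (cycle_adj i k)%:R * hartley_mx k j
  = hartley_mx i j * (2 * cos (cycle_angle j)).
Proof.
under eq_bigr do rewrite cycle_adjE // mulrDl [_ == ordS i]eq_sym
  [_ == ord_pred i]eq_sym.
(* With k the predecessor of i, the three vertices are k, [ordS k] and [ordS (ordS k)], so only
   successors have to be reduced modulo n. *)
rewrite big_split /= !sum_eq_mull -[i in ordS i]ord_predK -[i in RHS]ord_predK.
move: (ord_pred i) => k; rewrite !mxE [RHS]mulrC -casD_add_casB /= !cas_modD.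
congr (_ + _); last by rewrite -natr1 mulrDl mul1r addrK.
rewrite -[_ * cycle_angle j in LHS]addr0 cas_modD addr0.
by rewrite -natr1 mulrDl mul1r cas_modD.
Qed.

(** The eigenvector equations read (y + A) H = H diag(y + 2 cos), and the nonzero determinant of the
    Hartley matrix H, seen over the polynomials, cancels. *)
Lemma adj_det_cycle (y : {poly R}) :
  fdet (adj_fun (G := cycle_graph n) y)
  = \prod_(j < n) (y + (2 * cos (cycle_angle j))%:P).
Proof.
rewrite (@fdet_bij _ (cycle_graph n) _ n id); last by exists id.
set H := map_mx polyC hartley_mx.
have H_neq0 : \det H != 0 by rewrite det_map_mx polyC_eq0 hartley_mx_det_neq0.
apply: (mulIf H_neq0); rewrite mulrC.
pose d := \row_(j < n) (y + (2 * cos (cycle_angle j))%:P).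
have -> : \prod_(j < n) (y + (2 * cos (cycle_angle j))%:P) = \det (diag_mx d).
  by rewrite det_diag; apply: eq_bigr => j _; rewrite mxE.
rewrite mulrC -det_mulmx [RHS]mulrC -det_mulmx; congr (\det _).
apply/matrixP=> i j; rewrite mul_mx_diag !mxE mulrDr.
under eq_bigr do rewrite !mxE /adj_fun mulrDl -mulrA.
rewrite big_split /= sum_eq_mull mulrC; congr (_ + _).
transitivity ((\sum_k (cycle_adj i k)%:R * hartley_mx k j)%:P).
  rewrite rmorph_sum; apply: eq_bigr => k _.
  by rewrite rmorphM rmorph_nat !mxE.
by rewrite cycle_adj_hartley polyCM !mxE.
Qed.

End CycleSpectrum.

Lemma size_uniq_le_card (T : finType) (s : seq T) :
  uniq s -> (size s <= #|T|)%N.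
Proof. by move=> /card_uniqP <-; apply: max_card. Qed.

Lemma det_block_scalar1 (S : comNzRingType) (a b c d : S) :
  \det (block_mx a%:M b%:M c%:M d%:M : 'M_(1 + 1)) = a * d - b * c.
Proof.
rewrite (expand_det_row _ (lshift 1 ord0)) big_split_ord /= !big_ord1.
rewrite block_mxEul block_mxEur !mxE eqxx !mulr1n /cofactor !det_mx11 !mxE /=.
have -> : @lift (1 + 1) (lshift 1 ord0) (ord0 : 'I_1) = rshift 1 ord0.
  exact: val_inj.
have -> : @lift (1 + 1) (rshift 1 ord0) (ord0 : 'I_1) = lshift 1 ord0.
  exact: val_inj.
by rewrite (unsplitK (inr ord0)) row_mxEl row_mxEr !mxE /= !mulr1n; ring.
Qed.

(** * Distances between vertices that are equal, adjacent or have a common neighbour *)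

Section DiameterTwo.
Variable G : sgraph.

Lemma has_path0 (u v : G) : has_path u v 0 = (u == v).
Proof.
apply/existsP/idP => [[p]|uv]; first by rewrite tuple0 /= andbT.
by exists [tuple]; rewrite /= uv.
Qed.

Lemma has_path1 (u v : G) : has_path u v 1 = adj u v.
Proof.
apply/existsP/idP => [[[[//|w [|//]] ?]]|uv] /=.
  by rewrite andbT => /and3P[? /eqP<-].
exists [tuple v]; rewrite /= uv eqxx inE /=.
by rewrite andbT; apply: contraTneq uv => ->; rewrite adj_irrefl.
Qed.

Lemma has_path2 (u w v : G) : u != v -> adj u w -> adj w v -> has_path u v 2.
Proof.
move=> uv uw wv; apply/existsP; exists [tuple w; v].
rewrite /= uw wv eqxx !inE negb_or uv !andbT /=.
by apply/andP; split; [apply: contraTneq uw | apply: contraTneq wv] => ->;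
  rewrite adj_irrefl.
Qed.

(** [find] tests the length k only if #|G| > k; the k + 1 distinct vertices of the path provide that
    bound in each case. *)
Lemma dist_diameter2 (u v : G) :
    (u != v -> ~~ adj u v -> exists w, adj u w && adj w v) ->
  dist u v = if u == v then 0%N else if adj u v then 1%N else 2.
Proof.
move=> common; rewrite /dist.
case: eqVneq => [<-|neq_uv].
  by have := @size_uniq_le_card G [:: u] isT; case: #|G| => //= ? _;
    rewrite has_path0 eqxx.
have [adj_uv|nadj_uv] := boolP (adj u v).
  have := @size_uniq_le_card G [:: u; v]; rewrite /= inE neq_uv => /(_ isT).
  case: #|G| => [|[|N]] //= _.
  by rewrite has_path0 (negbTE neq_uv) has_path1 adj_uv.
have [w /andP[uw wv]] := common neq_uv nadj_uv.
have := @size_uniq_le_card G [:: u; w; v].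
rewrite /= !inE negb_or neq_uv !andbT.
have -> : u != w by apply: contraTneq uw => ->; rewrite adj_irrefl.
have -> : w != v by apply: contraTneq wv => ->; rewrite adj_irrefl.
move=> /(_ isT); case: #|G| => [|[|[|N]]] //= _.
rewrite has_path0 (negbTE neq_uv) has_path1 (negbTE nadj_uv).
by rewrite (has_path2 neq_uv uw wv).
Qed.

End DiameterTwo.

(** * Characteristic polynomial of a join of regular graphs *)

Lemma sum_dist_regular (R : comNzRingType) (G : sgraph) (r : nat) (u : G) :
    (\sum_v adj u v)%N = r ->
  \sum_v (2 - 2 * (u == v)%:R - (adj u v)%:R) = 2 * #|G|%:R - 2 - r%:R :> R.
Proof.
move=> <-; rewrite !sumrB sumr_const natr_sum mulr_natr -mulr_sumr.
suff -> : \sum_v (u == v)%:R = 1 :> R by rewrite mulr1.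
rewrite -[RHS](sum_eq_mull u (fun=> 1)).
by apply: eq_bigr => v _; rewrite mulr1.
Qed.

Lemma char_poly_dist_signless_laplacian (R : realType) (G : sgraph) :
  char_poly (dist_signless_laplacian R G)
  = fdet (fun u v : G => (u == v)%:R * ('X - (\sum_w (dist u w)%:R)%:P)
                         - (dist u v)%:R).
Proof.
congr (\det _); apply/matrixP=> i j; rewrite !mxE (inj_eq enum_val_inj).
under eq_bigr do rewrite !mxE.
rewrite (sum_enum_val (fun w : G => (dist (enum_val i) w)%:R)).
rewrite polyCD rmorphMn rmorph_nat /=.
by case: (i == j); rewrite ?mulr1n ?mulr0n ?mul1r ?mul0r; ring.
Qed.

(** The index type is that of [block_mx] and [T1] comes first, so a determinant over the sum type
    becomes that of a block matrix. *)
Definition sum_enum_ord (T1 T2 : finType) (i : 'I_(#|T1| + #|T2|)) :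
    (T1 + T2)%type :=
  match split i with
  | inl a => inl (enum_val a)
  | inr b => inr (enum_val b)
  end.

Lemma sum_enum_ord_bij (T1 T2 : finType) : bijective (@sum_enum_ord T1 T2).
Proof.
exists (fun u => unsplit
  match u with inl x => inl (enum_rank x) | inr y => inr (enum_rank y) end).
  by move=> i; rewrite /sum_enum_ord; case: splitP => k eq_ik;
    apply: val_inj; rewrite /= enum_valK.
by move=> u; rewrite /sum_enum_ord unsplitK; case: u => u; rewrite enum_rankK.
Qed.

Lemma adj_fun_const (S : comNzRingType) (G : sgraph) (r : nat) (y : S) :
    (forall u : G, (\sum_v adj u v)%N = r) ->
  (\matrix_(i < #|G|, j < #|G|) adj_fun y (enum_val i) (enum_val j))
    *m (const_mx 1 : 'cV_#|G|) = const_mx (y + r%:R).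
Proof.
move=> regG; apply/matrixP=> i j; rewrite !mxE.
under eq_bigr do rewrite !mxE mulr1.
rewrite (sum_enum_val (adj_fun y (enum_val i))) big_split /= sum_eq_mull.
by rewrite -natr_sum regG.
Qed.

Section JoinSpectrum.
Variables (R : realType) (G1 G2 : sgraph) (r1 r2 : nat).
Hypothesis regG1 : forall u : G1, (\sum_v adj u v)%N = r1.
Hypothesis regG2 : forall u : G2, (\sum_v adj u v)%N = r2.
Hypotheses (G1_gt0 : (0 < #|G1|)%N) (G2_gt0 : (0 < #|G2|)%N).
Let n1 := #|G1|.
Let n2 := #|G2|.
Let J := join_graph G1 G2.

(** Vertices on one side have every vertex of the other side as a common neighbour, and neither side
    is empty. The ring is arbitrary since the formula serves in R for transmissions and in the
    polynomials for matrix entries. *)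
Lemma dist_join (S : comNzRingType) (u v : J) : (dist u v)%:R =
  match u, v with
  | inl _, inl _ | inr _, inr _ => 2 - 2 * (u == v)%:R - (adj u v)%:R
  | _, _ => 1
  end :> S.
Proof.
rewrite dist_diameter2; last first.
  have [x1 _] := card_gt0P G1_gt0; have [x2 _] := card_gt0P G2_gt0.
  by case: u v => [u|u] [v|v] //= _ _; [exists (inr x2) | exists (inl x1)].
case: u v => [u|u] [v|v] //; case: eqP => [->|_].
- by rewrite adj_irrefl /=; ring.
- by case: (adj _ _) => /=; ring.
- by rewrite adj_irrefl /=; ring.
- by case: (adj _ _) => /=; ring.
Qed.

Lemma sum_dist_joinl (u : G1) :
  \sum_(v : J) (dist (inl u : J) v)%:R = 2 * n1%:R - 2 - r1%:R + n2%:R :> R.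
Proof.
rewrite big_sumType /=; congr (_ + _).
  rewrite -(sum_dist_regular R (regG1 u)).
  by apply: eq_bigr => v _; rewrite dist_join.
under eq_bigr do rewrite dist_join.
by rewrite sumr_const.
Qed.

Lemma sum_dist_joinr (u : G2) :
  \sum_(v : J) (dist (inr u : J) v)%:R = 2 * n2%:R - 2 - r2%:R + n1%:R :> R.
Proof.
rewrite big_sumType /= addrC; congr (_ + _).
  rewrite -(sum_dist_regular R (regG2 u)).
  by apply: eq_bigr => v _; rewrite dist_join.
under eq_bigr do rewrite dist_join.
by rewrite sumr_const.
Qed.

(** The constants in y1 and y2 are the transmissions minus 2: inside one side, -D is 2 I + A minus
    the constant matrix 2. The factors on the left are the eigenvalues of the blocks y1 + A1 and y2
    + A2 on the all-ones vectors. *)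
Lemma join_char_poly (y1 y2 : {poly R}) :
    y1 = 'X - (2 * n1%:R - 4 - r1%:R + n2%:R)%:P ->
    y2 = 'X - (2 * n2%:R - 4 - r2%:R + n1%:R)%:P ->
  char_poly (dist_signless_laplacian R J) * ((y1 + r1%:R) * (y2 + r2%:R))
  = fdet (adj_fun (G := G1) y1) * fdet (adj_fun (G := G2) y2)
    * ((y1 + r1%:R - 2 * n1%:R) * (y2 + r2%:R - 2 * n2%:R) - n1%:R * n2%:R).
Proof.
move=> y1E y2E.
rewrite char_poly_dist_signless_laplacian (fdet_bij _ (sum_enum_ord_bij G1 G2)).
pose A (G : sgraph) (y : {poly R}) : 'M_#|G| :=
  \matrix_(i, j) adj_fun y (enum_val i) (enum_val j).
pose B := block_mx (A G1 y1) 0 0 (A G2 y2).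
pose U : 'M[{poly R}]_(n1 + n2, 1 + 1) :=
  block_mx (const_mx 1) 0 0 (const_mx 1).
(* [W] is C U^T, so [U *m W] has constant blocks: 2 within a side, 1 across. *)
pose W : 'M[{poly R}]_(1 + 1, n1 + n2) :=
  block_mx (const_mx 2) (const_mx 1) (const_mx 1) (const_mx 2).
pose D : 'M[{poly R}]_(1 + 1) :=
  block_mx (y1 + r1%:R)%:M 0 0 (y2 + r2%:R)%:M.
have BU : B *m U = U *m D.
  rewrite !mulmx_block !mulmx0 !mul0mx !addr0 !add0r (adj_fun_const _ regG1)
    (adj_fun_const _ regG2).
  congr block_mx; apply/matrixP=> i j; rewrite mul_mx_scalar !mxE mulr1 //.
have detD : \det D = (y1 + r1%:R) * (y2 + r2%:R).
  by rewrite det_ublock !det_scalar1.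
have WU : W *m U = block_mx (2 * n1%:R)%:M n2%:R%:M n1%:R%:M (2 * n2%:R)%:M.
  rewrite mulmx_block !mulmx0 !addr0 !add0r.
  by congr block_mx; apply/matrixP=> i j; rewrite !ord1 !mxE;
    under eq_bigr do rewrite !mxE mulr1;
    rewrite sumr_const card_ord ?mulr_natr.
transitivity (\det (B - U *m W) * \det D); last first.
  rewrite (det_intertwine W BU) det_ublock WU; congr (_ * _).
  rewrite /D opp_block_mx add_block_mx !sub0r.
  rewrite -!raddfN -!raddfD det_block_scalar1 mulrNN.
  by rewrite [n2%:R * _]mulrC.
rewrite detD; congr (\det _ * _).
have UW : U *m W =
    block_mx (const_mx 2) (const_mx 1) (const_mx 1) (const_mx 2).
  rewrite mulmx_block !mul0mx !addr0 !add0r.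
  by congr block_mx; apply/matrixP=> i j; rewrite !mxE big_ord1 !mxE mul1r.
rewrite UW opp_block_mx add_block_mx !sub0r; apply/matrixP=> i j.
rewrite mxE -(splitK i) -(splitK j) /sum_enum_ord !unsplitK.
case: (split i) => u; case: (split j) => v.
- rewrite block_mxEul !mxE dist_join sum_dist_joinl y1E /adj_fun /=.
  rewrite !(rmorphD, rmorphB, rmorphN, rmorphM, rmorph_nat) /=.
  by rewrite (inj_eq inl_inj); case: (_ == _); rewrite /=; ring.
- by rewrite block_mxEur !mxE dist_join mul0r sub0r.
- by rewrite block_mxEdl !mxE dist_join mul0r sub0r.
- rewrite block_mxEdr !mxE dist_join sum_dist_joinr y2E /adj_fun /=.
  rewrite !(rmorphD, rmorphB, rmorphN, rmorphM, rmorph_nat) /=.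
  by rewrite (inj_eq inr_inj); case: (_ == _); rewrite /=; ring.
Qed.

End JoinSpectrum.

(** * The generalized wheel *)

Lemma copies_complete_regular (a m : nat) (u : copies a (complete_graph m)) :
  (\sum_v adj u v)%N = (m - 1)%N.
Proof.
case: u => p u; pose G := copies a (complete_graph m).
rewrite -(pair_bigA _ (fun q v => nat_of_bool (adj (s := G) (p, u) (q, v)))) /=.
rewrite (bigD1 p) //= [X in (_ + X)%N]big1 => [|q neq_qp]; last first.
  by apply: big1 => v _; rewrite /copies_adj /= eq_sym (negbTE neq_qp).
rewrite addn0 /copies_adj /= (bigD1 u) //= eqxx /complete_adj eqxx add0n.
rewrite (eq_bigr (fun=> 1%N)) => [|v]; last by rewrite eq_sym => ->.
by rewrite sum1_card cardC1 card_ord subn1.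
Qed.

Lemma cycle_regular (n : nat) (i : cycle_graph n) :
  (2 < n)%N -> (\sum_j adj i j = 2)%N.
Proof.
(* The count is moved to [int] because [cycle_adjE] is an identity in a ring. *)
move=> n_gt2; apply/eqP; rewrite -(eqr_nat int) natr_sum /=.
rewrite (eq_bigr (fun j => 1 * (j == ordS i)%:R + 1 * (j == ord_pred i)%:R)).
  by rewrite big_split /= !sum_eq_mulr.
by move=> j _; rewrite cycle_adjE ?mul1r.
Qed.

Lemma prod_nseq (S : comNzRingType) (T : Type) (k : nat) (x : T) (F : T -> S) :
  \prod_(y <- nseq k x) F y = F x ^+ k.
Proof. by rewrite big_nseq iter_mulr_1. Qed.

(** By Vieta, s and p are the sum and the product of the roots; a nonnegative discriminant is the
    square of its [Num.sqrt]. *)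
Lemma prod_quadratic (R : realType) (s p : R) : 0 <= s ^+ 2 - 4 * p ->
  ('X - (s / 2 + Num.sqrt (s ^+ 2 - 4 * p) / 2)%:P)
    * ('X - (s / 2 - Num.sqrt (s ^+ 2 - 4 * p) / 2)%:P)
  = 'X^2 - s%:P * 'X + p%:P.
Proof.
move=> /sqr_sqrtr; set q := Num.sqrt _ => qE.
have sE : s%:P = (s / 2 + q / 2)%:P + (s / 2 - q / 2)%:P.
  by rewrite -polyCD; congr (_%:P); field.
have pE : p%:P = (s / 2 + q / 2)%:P * (s / 2 - q / 2)%:P.
  rewrite -polyCM; congr (_%:P); transitivity ((s ^+ 2 - q ^+ 2) / 4).
    by rewrite qE; field.
  by field.
rewrite sE pE; ring.
Qed.

Theorem theorem2p1 (R : realType) (a m n : nat)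
    (ha : (1 <= a)%N) (hm : (1 <= m)%N) (hn : (3 <= n)%N) :
  is_spectrum (dist_signless_laplacian R (generalized_wheel a m n))
    (nseq (a - 1) (2 * (a%:R - 1) * m%:R + n%:R - 2)
     ++ nseq (a * (m - 1)) ((2 * a%:R - 1) * m%:R + n%:R - 2)
     ++ [seq a%:R * m%:R + 2 * n%:R - 6 - 2 * cos (2 * pi * j%:R / n%:R)
          | j <- index_iota 1 n]
     ++ [:: ((5 * a%:R - 2) * m%:R + 5 * n%:R - 10) / 2
            + Num.sqrt (((3 * a%:R - 2) * m%:R - 3 * n%:R + 6) ^+ 2
                        + 4 * a%:R * m%:R * n%:R) / 2;
            ((5 * a%:R - 2) * m%:R + 5 * n%:R - 10) / 2
            - Num.sqrt (((3 * a%:R - 2) * m%:R - 3 * n%:R + 6) ^+ 2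
                        + 4 * a%:R * m%:R * n%:R) / 2]).
Proof.
rewrite /is_spectrum.
have n_gt0 : (0 < n)%N by apply: leq_trans hn.
have cardK : #|copies a (complete_graph m)| = (a * m)%N.
  by rewrite card_prod !card_ord.
have cardC : #|cycle_graph n| = n by rewrite card_ord.
pose c0 : R := 2 * (a%:R - 1) * m%:R + n%:R - 2.
pose c1 : R := (2 * a%:R - 1) * m%:R + n%:R - 2.
pose c2 : R := a%:R * m%:R + 2 * n%:R - 6.
rewrite -/c0 -/c1 -/c2.
have c0E : c0 = 2 * (a%:R - 1) * m%:R + n%:R - 2 by [].
have c1E : c1 = (2 * a%:R - 1) * m%:R + n%:R - 2 by [].
have c2E : c2 = a%:R * m%:R + 2 * n%:R - 6 by [].
(* Otherwise [ring] and the morphism lemmas see through the definitions. *)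
clearbody c0 c1 c2.
have regC (i : cycle_graph n) : (\sum_j adj i j = 2)%N by apply: cycle_regular.
have KC_pos :
    (0 < #|copies a (complete_graph m)|)%N /\ (0 < #|cycle_graph n|)%N.
  by rewrite cardK cardC muln_gt0 ha hm.
(* With this y1, y1 - 1 is 'X - c1, the factor of exponent a (m - 1), and y1 + r1 is 'X - c0. *)
have := join_char_poly (R := R) (@copies_complete_regular a m) regC
  KC_pos.1 KC_pos.2 (y1 := 'X - c1%:P + 1) (y2 := 'X - c2%:P).
rewrite cardK cardC !natrM !natrB //.
have y1E : 'X - c1%:P + 1
    = 'X - (2 * (a%:R * m%:R) - 4 - (m%:R - 1) + n%:R)%:P.
  by rewrite c1E !(rmorphD, rmorphB, rmorphM, rmorph_nat, rmorph1) /=; ring.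
have <- : c2 = 2 * n%:R - 4 - 2 + a%:R * m%:R by rewrite c2E; ring.
move=> /(_ y1E erefl).
rewrite adj_det_copies_complete //; last first.
  by rewrite -subr_eq0 addrK polyXsubC_eq0.
rewrite adj_det_cycle // addrK.
have y1mE : 'X - c1%:P + m%:R = 'X - c0%:P.
  by rewrite c0E c1E !(rmorphD, rmorphB, rmorphM, rmorph_nat, rmorph1); ring.
have -> : 'X - c1%:P + 1 + (m%:R - 1) = 'X - c0%:P by rewrite -y1mE; ring.
rewrite y1mE => charE.
(* These are the factors y1 + r1 and y2 + r2. Cancelling the first lowers the exponent of 'X - c0
   from a to a - 1; cancelling the second removes the factor j = 0 of the cycle. *)
have q_neq0 : ('X - c0%:P) * ('X - c2%:P + 2) != 0.
  rewrite mulf_neq0 ?polyXsubC_eq0 //.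
  have -> : 'X - c2%:P + 2 = 'X - (c2 - 2)%:P.
    by rewrite rmorphB rmorph_nat; ring.
  by rewrite polyXsubC_eq0.
apply: (mulIf q_neq0); rewrite charE.
rewrite !big_cat /= !prod_nseq big_map big_cons big_seq1.
(* The remaining factor is ('X - u) ('X - v) - a m n with u = c0 + 2 a m and v = c2 - 2 + 2 n; hence
   s = u + v and p = u v - a m n. *)
pose s := (5 * a%:R - 2) * m%:R + 5 * n%:R - 10 : R.
pose p := (c0 + 2 * a%:R * m%:R) * (c2 - 2 + 2 * n%:R) - a%:R * m%:R * n%:R : R.
have discE : ((3 * a%:R - 2) * m%:R - 3 * n%:R + 6) ^+ 2
    + 4 * a%:R * m%:R * n%:R = s ^+ 2 - 4 * p.
  by rewrite /s /p c0E c2E; ring.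
rewrite discE prod_quadratic -?discE; last first.
  by rewrite addr_ge0 ?sqr_ge0 // !mulr_ge0.
rewrite -(big_mkord xpredT
  (fun j => 'X - c2%:P + (2 * cos (cycle_angle R n j))%:P)).
rewrite big_ltn // {1}/cycle_angle mulr0 mul0r cos0 mulr1.
have -> : \prod_(1 <= j < n) ('X - c2%:P + (2 * cos (cycle_angle R n j))%:P)
    = \prod_(j <- index_iota 1 n)
        ('X - (c2 - 2 * cos (2 * pi * j%:R / n%:R))%:P).
  by apply: eq_bigr => j _; rewrite polyCB opprB addrCA addrC addrAC -addrA.
have -> : 'X - c0%:P - 2 * (a%:R * m%:R) = 'X - (c0 + 2 * a%:R * m%:R)%:P.
  by rewrite !(rmorphD, rmorphB, rmorphM, rmorph_nat, rmorph1) /=; ring.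
have -> : 'X - c2%:P + 2 - 2 * n%:R = 'X - (c2 - 2 + 2 * n%:R)%:P.
  by rewrite !(rmorphD, rmorphB, rmorphN, rmorphM, rmorph_nat) /=; ring.
rewrite -/s; have -> : s = c0 + 2 * a%:R * m%:R + (c2 - 2 + 2 * n%:R).
  by rewrite /s c0E c2E; ring.
rewrite /p; move: (c0 + _) (c2 - 2 + _) => u v.
rewrite !(rmorphD, rmorphB, rmorphM, rmorph_nat) /=.
have -> : ('X - c0%:P) ^+ a = ('X - c0%:P) ^+ (a - 1) * ('X - c0%:P).
  by rewrite -exprSr -addn1 subnK.
move: (\prod_(_ <= _ < _) _) => P; ring.
Qed.
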